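(* Let $n\geq 3$ and let ${\cal C}$ be a cap in $R^n$. Then (i) $\rho_i({\cal C})$ is a $|{\cal C}|$-cap in $R_i^n$, and $\pi_i(\rho_i({\cal C}))$ is a $|{\cal C}|$-cap in $(R_i/M_i)^n$, for all $i\in[\ell]$; (ii) ${\cal C}$ is complete if and only if there exists some $i_0\in[\ell]$ such that $\pi_{i_0}(\rho_{i_0}({\cal C}))$ is complete.
   Context: $R$ is a finite commutative ring with identity $1\neq0$, written as $R=R_1\times\cdots\times R_\ell$ with $R_i$ finite local rings with maximal ideals $M_i$; $\rho_i:R\to R_i$ is the projection and $\pi_i:R_i\to R_i/M_i$ the natural map, both applied entrywise to vectors. For a commutative ring $S$, a set of vectors in $S^n$ is unimodular if the matrix having them as rows has a right inverse; an $m$-subspace of $S^n$ is a submodule with a basis of $m$ vectors forming a unimodular set; points are $1$-subspaces $\langle\alpha\rangle$. A $k$-cap in $S^n$ ($n\ge3$) is a set of $k$ points such that any $3$ of them span a $3$-subspace of $S^n$. A cap is complete if it is not contained in a larger cap. For a set ${\cal S}$ of points of $R^n$, $\rho_i({\cal S})=\{\langle\rho_i(\alpha)\rangle:\langle\alpha\rangle\in{\cal S}\}$ and $\pi_i(\rho_i({\cal S}))=\{\langle\pi_i(\rho_i(\alpha))\rangle:\langle\alpha\rangle\in{\cal S}\}$.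
   Formalization: The cap C is assumed not to have exactly 2 points: for two points the cap condition is vacuous, and the statement fails, e.g. over Z/4 with the points ⟨(1,0,0)⟩ and ⟨(1,2,0)⟩, which coincide modulo 2. *)

(* Defs.v *)
From HB Require Import structures.
From mathcomp Require Import all_boot all_order all_algebra.

Set Implicit Arguments.
Unset Strict Implicit.
Unset Printing Implicit Defensive.

Import GRing.Theory.
Local Open Scope ring_scope.
Local Open Scope quotient_scope.

Section ResidueRing.
Variables (S : finComNzRingType) (M : idealr S).

(* The library does not declare {ideal_quot M} finite when S is. *)
HB.instance Definition _ := Choice_isCountable.Build {ideal_quot M}
  (pcan_pickleK (can_pcan (@reprK S {ideal_quot M}))).
HB.instance Definition _ := isFinite.Build {ideal_quot M}
  (pcan_enumP (can_pcan (@reprK S {ideal_quot M}))).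

Definition residue_ring : finComNzRingType := {ideal_quot M}.
Definition residue_map : S -> residue_ring := \pi_{ideal_quot M}.

End ResidueRing.

(* In the library, idealr_closed and idealr denote proper ideals. *)
Definition maximal_ideal (S : comNzRingType) (M : {pred S}) : Prop :=
  idealr_closed M /\
  forall J : {pred S}, idealr_closed J -> {subset M <= J} -> {subset J <= M}.

Definition local_ring (S : comNzRingType) (M : {pred S}) : Prop :=
  maximal_ideal M /\ forall J : {pred S}, maximal_ideal J -> J =i M.

(* R = R_1 x ... x R_l with projections rho: the ring morphism               *)
(* x |-> (rho_1 x, ..., rho_l x) is a bijection onto the product.            *)
Definition ring_product (l : nat) (R : finComNzRingType)
    (Rs : 'I_l -> finComNzRingType) (rho : forall i, {rmorphism R -> Rs i}) :
    Prop :=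
  forall x : (forall i, Rs i), exists! r : R, forall i, rho i r = x i.

Section Caps.
Variables (S : finComNzRingType) (n : nat).
Implicit Types (U V : {set 'rV[S]_n}) (C D : {set {set 'rV[S]_n}}).

Definition unimodular (m : nat) (A : 'M[S]_(m, n)) : Prop :=
  exists B : 'M[S]_(n, m), A *m B = 1%:M.

Definition rowspan (m : nat) (A : 'M[S]_(m, n)) : {set 'rV[S]_n} :=
  [set u *m A | u : 'rV[S]_m].

Definition is_basis (m : nat) (A : 'M[S]_(m, n)) U : Prop :=
  (forall u : 'rV[S]_m, u *m A = 0 -> u = 0) /\ rowspan A = U.

Definition is_subspace (m : nat) U : Prop :=
  exists A : 'M[S]_(m, n), is_basis A U /\ unimodular A.

Definition is_point U : Prop := is_subspace 1 U.

Definition addsm U V : {set 'rV[S]_n} := [set u + v | u in U, v in V].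

(* The span of three submodules is their sum. The condition on triples is    *)
(* vacuous when k < 3; in particular any two distinct points form a 2-cap,   *)
(* even if they have the same image over a residue field.                    *)
Definition is_kcap (k : nat) C : Prop :=
  [/\ #|C| = k,
      {in C, forall p, is_point p} &
      {in C & &, forall p q r, p != q -> p != r -> q != r ->
         is_subspace 3 (addsm (addsm p q) r)}].

Definition is_cap C : Prop := exists k, is_kcap k C.

Definition complete_cap C : Prop :=
  is_cap C /\ ~ exists D, is_cap D /\ C \proper D.

End Caps.

(* { <f(a)> : <a> \in C }, with f applied entrywise *)
Definition image_points (S T : finComNzRingType) (f : S -> T) (n : nat)
    (C : {set {set 'rV[S]_n}}) : {set {set 'rV[T]_n}} :=
  [set rowspan (map_mx f a) | a : 'rV[S]_n & rowspan a \in C].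

(* Main.v *)
Require Import Defs.
From HB Require Import structures.
From mathcomp Require Import all_boot all_order all_algebra.
From Stdlib Require Import Classical.
Import GRing.Theory.

Set Implicit Arguments.
Unset Strict Implicit.
Unset Printing Implicit Defensive.

Local Open Scope ring_scope.

(** Three points with generators a, b, c span a 3-subspace iff the 3 x n matrix
    with rows a, b, c is unimodular.  Ring morphisms preserve unimodularity;
    conversely, a matrix over R is unimodular as soon as all its residue images
    are: lift the right inverses B_i to a single B over R, and note that
    det (A B) is congruent to 1 modulo every M_i, hence a unit.
    If no residue image of C is complete, extend each by a point and lift the
    new points to a single point of R^n, which extends C. *)

(** * Row spans, points and caps in terms of generator matrices *)

Section Rowspan.
Variables (S : finComNzRingType) (n : nat).

Lemma mem_rowspan m (A : 'M[S]_(m, n)) (u : 'rV_m) : u *m A \in rowspan A.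
Proof. by apply/imsetP; exists u. Qed.

Lemma rowspan_eqP m1 m2 (A : 'M[S]_(m1, n)) (B : 'M[S]_(m2, n)) :
  rowspan A = rowspan B -> exists X, A = X *m B.
Proof.
move=> eqAB.
have /fin_all_exists[x xE] (i : 'I_m1) : exists u : 'rV_m2, row i A = u *m B.
  have : row i A \in rowspan B by rewrite -eqAB rowE mem_rowspan.
  by case/imsetP=> u _ ->; exists u.
exists (\matrix_i x i); apply/row_matrixP=> i.
by rewrite xE row_mul rowK.
Qed.

Lemma rowspan_mulS m1 m2 (X : 'M[S]_(m1, m2)) (B : 'M[S]_(m2, n)) :
  rowspan (X *m B) \subset rowspan B.
Proof. by apply/subsetP=> _ /imsetP[u _ ->]; rewrite mulmxA mem_rowspan. Qed.

Lemma rowspan_col_mx m1 m2 (A : 'M[S]_(m1, n)) (B : 'M[S]_(m2, n)) :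
  rowspan (col_mx A B) = addsm (rowspan A) (rowspan B).
Proof.
apply/setP=> v; apply/imsetP/imset2P.
  case=> u _ ->; rewrite -(hsubmxK u) mul_row_col.
  by exists (lsubmx u *m A) (rsubmx u *m B); rewrite ?mem_rowspan.
case=> _ _ /imsetP[u _ ->] /imsetP[w _ ->] ->.
by exists (row_mx u w); rewrite ?mul_row_col.
Qed.

Lemma unimodular_subspace m (A : 'M[S]_(m, n)) :
  unimodular A -> is_subspace m (rowspan A).
Proof.
move=> [B AB]; exists A; split; last by exists B.
by split=> // u uA0; rewrite -[u]mulmx1 -AB mulmxA uA0 mul0mx.
Qed.

(** A unimodular basis [A'] of the same span satisfies [A' = X *m A], so [X] is a left inverse of
    the square matrix [A *m B]. Over a commutative ring it is then also a right inverse. *)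
Lemma subspace_unimodular m (A : 'M[S]_(m, n)) :
  is_subspace m (rowspan A) -> unimodular A.
Proof.
case=> A' [[_ /rowspan_eqP[X defA']] [B]].
rewrite defA' -mulmxA => /mulmx1C XAB.
by exists (B *m X); rewrite mulmxA.
Qed.

Lemma pointP U : is_point U <-> exists2 a : 'rV[S]_n, U = rowspan a & unimodular a.
Proof.
split=> [[a [[_ <-] ua]] | [a -> /unimodular_subspace //]].
by exists a.
Qed.

Definition triple (a b c : 'rV[S]_n) : 'M[S]_(1 + 1 + 1, n) :=
  col_mx (col_mx a b) c.

Lemma rowspan_triple a b c :
  rowspan (triple a b c) = addsm (addsm (rowspan a) (rowspan b)) (rowspan c).
Proof. by rewrite !rowspan_col_mx. Qed.

(** If [a = x *m b], the row vector (1, -x, 0) annihilates the triple; the right inverse forces this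
    vector to be 0, against 1 != 0. *)
Lemma unimodular_triple_neq a b c :
  unimodular (triple a b c) -> rowspan a != rowspan b.
Proof.
move=> [B tB]; apply/eqP=> /rowspan_eqP[x defa].
pose u : 'rV[S]_(1 + 1 + 1) := row_mx (row_mx 1%:M (- x)) (0 : 'rV_1).
have u0 : u = 0.
  rewrite -[u]mulmx1 -tB mulmxA /u /triple mul_row_col.
  by rewrite mul_row_col mul1mx mulNmx -defa subrr mul0mx addr0 mul0mx.
have u1 : u 0 (lshift 1 (lshift 1 0)) = 1 by rewrite !row_mxEl mxE eqxx.
by have := oner_neq0 S; rewrite -u1 u0 mxE eqxx.
Qed.

Lemma cap_unimodular {C} {a : 'rV[S]_n} :
  is_cap C -> rowspan a \in C -> unimodular a.
Proof. by case=> k [_ ptC _] /ptC/subspace_unimodular. Qed.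

Lemma cap_triple {C} {a b c : 'rV[S]_n} :
  is_cap C -> rowspan a \in C -> rowspan b \in C -> rowspan c \in C ->
  rowspan a != rowspan b -> rowspan a != rowspan c -> rowspan b != rowspan c ->
  unimodular (triple a b c).
Proof.
case=> k [_ _ trC] Ca Cb Cc ab ac bc.
by apply: subspace_unimodular; rewrite rowspan_triple; apply: trC.
Qed.

Lemma kcapI (C : {set {set 'rV[S]_n}}) :
    {in C, forall p, is_point p} ->
    (forall a b c : 'rV[S]_n,
      rowspan a \in C -> rowspan b \in C -> rowspan c \in C ->
      rowspan a != rowspan b -> rowspan a != rowspan c ->
      rowspan b != rowspan c -> unimodular (triple a b c)) ->
  is_kcap #|C| C.
Proof.
move=> ptC trC; split=> // p q r Cp Cq Cr pq pr qr.
case/pointP: (ptC _ Cp) => a defp _; case/pointP: (ptC _ Cq) => b defq _.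
case/pointP: (ptC _ Cr) => c defr _; subst p q r.
by rewrite -rowspan_triple; apply: unimodular_subspace; apply: trC.
Qed.

(** One of the points spanned by the first two unit vectors is missing from [E]. Adding it leaves at
    most two points, so the condition on triples is vacuous. *)
Lemma cap_lt2_extend (E : {set {set 'rV[S]_n}}) :
  (1 < n)%N -> is_cap E -> (#|E| < 2)%N ->
  exists D, is_cap D /\ E \proper D.
Proof.
move=> n_gt1 [k [_ ptE _]] ltE2.
pose e i (ltin : (i < n)%N) : 'rV[S]_n := delta_mx 0 (Ordinal ltin).
have ue i (ltin : (i < n)%N) : unimodular (e i ltin).
  exists (delta_mx (Ordinal ltin) 0); rewrite mul_delta_mx.
  by apply/matrixP=> x y; rewrite !ord1 !mxE eqxx.
pose a := e _ (ltnW n_gt1); pose b := e _ n_gt1.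
have ab : rowspan a != rowspan b.
  (* At the first coordinate [a] is 1, while every multiple of [b] is 0. *)
  apply/eqP=> /rowspan_eqP[x] /matrixP/(_ 0 (Ordinal (ltnW n_gt1))).
  rewrite !mxE big_ord1 !mxE !eqxx /= mulr0 => /eqP.
  by rewrite oner_eq0.
have [p ptp nEp] : exists2 p, is_point p & p \notin E.
  have [Ea|] := boolP (rowspan a \in E); last first.
    by move=> nEa; exists (rowspan a) => //; apply: unimodular_subspace (ue _ _).
  exists (rowspan b); first exact: unimodular_subspace (ue _ _).
  apply: contraL ltE2 => Eb; rewrite -leqNgt.
  rewrite (cardsD1 (rowspan a)) Ea (cardsD1 (rowspan b)) !inE eq_sym ab Eb.
  by rewrite addnA leq_addr.
exists (p |: E); split; last first.
  by apply/properP; split; [exact: subsetUr | exists p; rewrite ?setU11].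
exists #|p |: E|; split=> // [q /setU1P[-> //|/ptE //]|q r s Dq Dr Ds qr qs rs].
have : (#|p |: E| <= 2)%N by rewrite cardsU1 nEp.
rewrite (cardsD1 q) Dq (cardsD1 r) in_setD1 eq_sym qr Dr.
by rewrite (cardsD1 s) !in_setD1 ![s == _]eq_sym qs rs Ds.
Qed.

End Rowspan.

(** * Images of caps under a ring morphism *)

Section ImagePoints.
Variables (S T : finComNzRingType) (f : {rmorphism S -> T}) (n : nat).

Lemma map_unimodular m (A : 'M[S]_(m, n)) : unimodular A -> unimodular (map_mx f A).
Proof. by case=> B AB; exists (map_mx f B); rewrite -map_mxM AB map_mx1. Qed.

Lemma map_triple (a b c : 'rV[S]_n) :
  map_mx f (triple a b c) = triple (map_mx f a) (map_mx f b) (map_mx f c).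
Proof. by rewrite /triple !map_col_mx. Qed.

(** This makes the image of a point independent of the chosen generator. *)
Lemma rowspan_map m1 m2 (A : 'M[S]_(m1, n)) (B : 'M[S]_(m2, n)) :
  rowspan A = rowspan B -> rowspan (map_mx f A) = rowspan (map_mx f B).
Proof.
move=> eqAB; apply/eqP; rewrite eqEsubset; apply/andP; split.
  by have [X ->] := rowspan_eqP eqAB; rewrite map_mxM rowspan_mulS.
by have [X ->] := rowspan_eqP (esym eqAB); rewrite map_mxM rowspan_mulS.
Qed.

Lemma mem_image_points (C : {set {set 'rV[S]_n}}) (a : 'rV[S]_n) :
  rowspan a \in C -> rowspan (map_mx f a) \in image_points f C.
Proof. by move=> Ca; apply/imsetP; exists a; rewrite ?inE. Qed.

Lemma image_pointsP (C : {set {set 'rV[S]_n}}) q :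
  reflect (exists2 a : 'rV[S]_n, rowspan a \in C & q = rowspan (map_mx f a))
          (q \in image_points f C).
Proof.
by apply: (iffP imsetP) => -[a Ca ->]; exists a; rewrite ?inE // in Ca *.
Qed.

(* Two distinct points may collapse under f; a third point of the cap, which
   exists because #|C| is not 2, forbids it. *)
Lemma cap_map_neq C (a b : 'rV[S]_n) : is_cap C -> #|C| <> 2%N ->
  rowspan a \in C -> rowspan b \in C -> rowspan a != rowspan b ->
  rowspan (map_mx f a) != rowspan (map_mx f b).
Proof.
move=> capC C_neq2 Ca Cb ab.
have [r Cr [ar br]] : exists2 r, r \in C & rowspan a != r /\ rowspan b != r.
  have [D0|[r]] := set_0Vmem (C :\ rowspan a :\ rowspan b); last first.
    by rewrite !inE ![r == _]eq_sym => /and3P[br ar Cr]; exists r.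
  case: C_neq2; rewrite (cardsD1 (rowspan a)) Ca (cardsD1 (rowspan b)).
  by rewrite D0 cards0 !inE eq_sym ab Cb.
have [_ [_ ptC _]] := capC; case/pointP: (ptC _ Cr) => c defr _; subst r.
have := map_unimodular (cap_triple capC Ca Cb Cr ab ar br).
by rewrite map_triple => /unimodular_triple_neq.
Qed.

Lemma card_image_points (C : {set {set 'rV[S]_n}}) :
  is_cap C -> #|C| <> 2%N -> #|image_points f C| = #|C|.
Proof.
move=> capC C_neq2; have [_ [_ ptC _]] := capC.
(* [image_points] is indexed by vectors; [g] turns it into the image of a map on points, so that
   injectivity gives the cardinality. The default [set0] is never reached on points. *)
pose g p : {set 'rV[T]_n} := if [pick a : 'rV[S]_n | p == rowspan a] is Some a
  then rowspan (map_mx f a) else set0.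
have gE (a : 'rV[S]_n) : g (rowspan a) = rowspan (map_mx f a).
  by rewrite /g; case: pickP => [b /eqP/rowspan_map | /(_ a)/eqP].
suff -> : image_points f C = g @: C.
  apply: card_in_imset => p q Cp Cq.
  case/pointP: (ptC _ Cp) => a defp _; case/pointP: (ptC _ Cq) => b defq _.
  subst p q; rewrite !gE; apply: contra_eq; exact: cap_map_neq capC C_neq2 Cp Cq.
apply/setP=> q; apply/image_pointsP/imsetP=> [[a Ca ->]|[p Cp ->]].
  by exists (rowspan a); rewrite ?gE.
case/pointP: (ptC _ Cp) => a defp _; subst p.
by exists a; rewrite ?gE.
Qed.

Lemma image_points_kcap (C : {set {set 'rV[S]_n}}) : is_cap C -> #|C| <> 2%N ->
  is_kcap #|C| (image_points f C).
Proof.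
move=> capC C_neq2; rewrite -card_image_points //; apply: kcapI.
  move=> _ /image_pointsP[a Ca ->]; apply: unimodular_subspace.
  exact: map_unimodular (cap_unimodular capC Ca).
move=> a' b' c' /image_pointsP[a Ca eqa] /image_pointsP[b Cb eqb].
move=> /image_pointsP[c Cc eqc] ab ac bc.
(* The generators [a'], [b'], [c'] need not be the images of [a], [b], [c], but unimodularity
   depends only on the span. *)
apply: (@subspace_unimodular _ _ (1 + 1 + 1)).
rewrite rowspan_triple eqa eqb eqc -rowspan_triple -map_triple.
apply/unimodular_subspace/map_unimodular/(cap_triple capC) => //.
- by apply: contra_neq ab => /rowspan_map; rewrite eqa eqb.
- by apply: contra_neq ac => /rowspan_map; rewrite eqa eqc.
- by apply: contra_neq bc => /rowspan_map; rewrite eqb eqc.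
Qed.

End ImagePoints.

(** * Maximal ideals and units in a finite local ring *)

Section LocalRing.
Variables (S : finComNzRingType).

(** Induction on the number of elements outside [J]: a proper ideal that is not maximal sits in a
    strictly larger proper ideal. *)
Lemma exists_maximal_ideal (J : {pred S}) : idealr_closed J ->
  exists2 M : {pred S}, maximal_ideal M & {subset J <= M}.
Proof.
have [k] := ubnP (#|S| - #|J|)%N; elim: k J => // k IHk J leJk idJ.
have [maxJ | nmaxJ] := classic (maximal_ideal J); first by exists J.
have [J' [idJ' [sJJ' nsJ'J]]] : exists J' : {pred S},
    idealr_closed J' /\ {subset J <= J'} /\ ~ {subset J' <= J}.
  apply: NNPP => none; apply: nmaxJ; split=> // J' idJ' sJJ'.
  by apply: NNPP => nsub; apply: none; exists J'.
have ltJ : (#|J| < #|J'|)%N.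
  apply: proper_card; rewrite properE; apply/andP; split; first exact/subsetP.
  by apply/negP=> /subsetP.
have [|M maxM sJ'M] := IHk J' _ idJ'; last first.
  by exists M => // x /sJJ'/sJ'M.
by rewrite -ltnS (leq_trans _ leJk) // ltnS ltn_sub2l // (leq_trans ltJ) ?max_card.
Qed.

(** If [x] were not a unit, its multiples would form a proper ideal, contained in some maximal
    ideal, which can only be [M]. *)
Lemma local_ring_unit (M : {pred S}) x : local_ring M -> x \notin M ->
  exists y, x * y = 1.
Proof.
move=> [_ uniqM] nMx; apply: NNPP => nunit.
pose J := [pred z : S | [exists y, z == x * y]].
have idJ : idealr_closed J.
  split=> [||r _ _ /existsP[u /eqP->] /existsP[v /eqP->]].
  - by apply/existsP; exists 0; rewrite mulr0.
  - by apply/existsP=> -[y /eqP xy]; apply: nunit; exists y.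
  - by apply/existsP; exists (r * u + v); rewrite mulrDr mulrCA.
have [M' maxM' sJM'] := exists_maximal_ideal idJ.
case/negP: nMx; rewrite -(uniqM M' maxM'); apply: sJM'.
by apply/existsP; exists 1; rewrite mulr1.
Qed.

End LocalRing.

(** * Descent and lifting along the residue maps of a product of local rings *)

Section Residues.
Variables (l : nat) (R : finComNzRingType) (Rs : 'I_l -> finComNzRingType).
Variables (M : forall i, idealr (Rs i)) (rho : forall i, {rmorphism R -> Rs i}).
Hypothesis Rs_local : forall i, local_ring (M i).
Hypothesis R_product : ring_product rho.

(** Convertible to [residue_map (M i) \o rho i], but packaged as a ring morphism. *)
Definition residue i : {rmorphism R -> residue_ring (M i)} :=
  (\pi_{ideal_quot (M i)}%qT : {rmorphism Rs i -> {ideal_quot (M i)}}) \o rho i.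

Lemma residue_eq0 i x : (residue i x == 0) = (rho i x \in M i).
Proof.
by rewrite -(rmorph0 (residue i)) /= -Quotient.idealrBE rmorph0 subr0.
Qed.

(** An empty product has a single element, which would give 0 = 1 in [R]. *)
Lemma ring_product_gt0 : (0 < l)%N.
Proof.
case: (posnP l) => // l0; case: (R_product (fun i => 0)) => r [_ uniq_r].
have noI (i : 'I_l) : False by case: i => m; rewrite l0.
have := oner_neq0 R.
by rewrite -(uniq_r 1) ?(uniq_r 0) ?eqxx // => i; case: (noI i).
Qed.

Lemma ring_product_unit x : (forall i, rho i x \notin M i) -> exists y, x * y = 1.
Proof.
move=> nMx.
have /fin_all_exists[y xy] i := local_ring_unit (Rs_local i) (nMx i).
have [z [rho_z _]] := R_product y; exists z.
(* Both [1] and [x * z] have all components equal to 1, so they agree by uniqueness. *)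
have [w [_ uniq_w]] := R_product (fun i => 1).
rewrite -(uniq_w 1) => [|i]; last exact: rmorph1.
by rewrite (uniq_w (x * z)) // => i; rewrite rmorphM rho_z xy.
Qed.

(** Entry by entry, choose a representative in each [Rs i] and glue these through the product
    decomposition. *)
Lemma residue_lift m n (A : forall i, 'M[residue_ring (M i)]_(m, n)) :
  exists B : 'M[R]_(m, n), forall i, map_mx (residue i) B = A i.
Proof.
have /fin_all_exists[b bE] (jk : 'I_m * 'I_n) :
    exists r, forall i, residue i r = A i jk.1 jk.2.
  have [r [rE _]] := R_product (fun i => repr (A i jk.1 jk.2)).
  by exists r => i; rewrite /= rE reprK.
exists (\matrix_(j, k) b (j, k)) => i.
by apply/matrixP=> j k; rewrite !mxE bE.
Qed.

Lemma residue_unimodular m n (A : 'M[R]_(m, n)) :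
  (forall i, unimodular (map_mx (residue i) A)) -> unimodular A.
Proof.
move=> /fin_all_exists[B' AB']; have [B BE] := residue_lift B'.
have [|y det_y] := @ring_product_unit (\det (A *m B)).
  by move=> i; rewrite -residue_eq0 -det_map_mx map_mxM BE AB' det1 oner_eq0.
(* Here [y] is the inverse of the determinant of [A *m B], so the adjugate formula gives the
   identity. *)
exists (y *: (B *m \adj (A *m B))).
by rewrite -scalemxAr mulmxA mul_mx_adj scale_scalar_mx mulrC det_y.
Qed.

(** A strictly larger cap [D] maps to a strictly larger cap over the residue field, unless [D] has
    two points, which may collapse. In that case [C] and its image have at most one point, and the
    image is extended directly. *)
Lemma complete_cap_of_residue n (C : {set {set 'rV[R]_n}}) i :
  (2 < n)%N -> is_cap C -> #|C| <> 2%N ->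
  complete_cap (image_points (residue i) C) -> complete_cap C.
Proof.
move=> n_ge3 capC C_neq2 [capI noI]; split=> // -[D [capD ltCD]]; apply: noI.
have cardI := card_image_points (residue i) capC C_neq2.
have [D2 | /eqP D_neq2] := eqVneq #|D| 2%N.
  apply: cap_lt2_extend => //; first exact: ltnW.
  by rewrite cardI -D2 proper_card.
exists (image_points (residue i) D); split.
  by exists #|D|; apply: image_points_kcap.
rewrite properEcard cardI card_image_points // proper_card // andbT.
apply/subsetP=> _ /image_pointsP[a Ca ->]; apply: mem_image_points.
exact: (subsetP (proper_sub ltCD)).
Qed.

Lemma residue_complete n (C : {set {set 'rV[R]_n}}) :
  #|C| <> 2%N -> complete_cap C ->
  exists i, complete_cap (image_points (residue i) C).
Proof.
move=> C_neq2 [capC noC]; apply: NNPP => noI; apply: noC.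
have /fin_all_exists[D DP] i : exists D,
    is_cap D /\ image_points (residue i) C \proper D.
  apply: NNPP => noD; apply: noI; exists i; split=> //.
  by exists #|C|; apply: image_points_kcap.
have /fin_all_exists[a' a'P] i : exists a : 'rV_n,
    rowspan a \in D i /\ rowspan a \notin image_points (residue i) C.
  case: (DP i) => -[k [_ ptD _]] /properP[_ [p Dp nCp]].
  by case/pointP: (ptD _ Dp) => a defp _; exists a; rewrite -defp.
have [a aE] := residue_lift a'.
pose i0 := Ordinal ring_product_gt0.
(* A single index suffices here: membership in [C] would put the residue of [a] into the image of
   [C]. *)
have nCa : rowspan a \notin C.
  have [_] := a'P i0; apply: contra; rewrite -aE; exact: mem_image_points.
have sub_D i (b : 'rV_n) : rowspan b \in rowspan a |: C ->
    rowspan (map_mx (residue i) b) \in D i.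
  case/setU1P=> [/(rowspan_map (residue i)) -> | Cb].
    by rewrite aE; case: (a'P i).
  have [_ /proper_sub/subsetP] := DP i; apply; exact: mem_image_points.
(* Distinct points stay distinct in every residue: the new one because its residue avoids the image
   of [C], the old ones by [cap_map_neq]. Hence their residues form unimodular triples in the cap
   [D i]. *)
have neq_D i (b c : 'rV_n) : rowspan b \in rowspan a |: C ->
    rowspan c \in rowspan a |: C ->
    rowspan b != rowspan c ->
    rowspan (map_mx (residue i) b) != rowspan (map_mx (residue i) c).
  have [_] := a'P i; rewrite -aE => nCa_i.
  case/setU1P=> [eqb|Cb]; case/setU1P=> [eqc|Cc] bc.
  - by rewrite eqb eqc eqxx in bc.
  - rewrite (rowspan_map (residue i) eqb).
    by apply: contraNneq nCa_i => ->; apply: mem_image_points.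
  - rewrite (rowspan_map (residue i) eqc).
    by apply: contraNneq nCa_i => <-; apply: mem_image_points.
  - exact: cap_map_neq capC C_neq2 Cb Cc bc.
exists (rowspan a |: C); split; last first.
  by apply/properP; split; [exact: subsetUr | exists (rowspan a); rewrite ?setU11].
exists #|rowspan a |: C|; apply: kcapI =>
  [p /setU1P[->|Cp] | b c d Db Dc Dd bc bd cd].
- apply/unimodular_subspace/residue_unimodular => i.
  by rewrite aE; apply: (cap_unimodular (DP i).1 (a'P i).1).
- by case: capC => k [_ ptC _]; apply: ptC.
- apply: residue_unimodular => i; rewrite map_triple.
  by apply: (cap_triple (DP i).1); rewrite ?sub_D ?neq_D.
Qed.

End Residues.

Theorem theorem6p4 (l : nat) (R : finComNzRingType)
    (Rs : 'I_l -> finComNzRingType) (M : forall i, idealr (Rs i))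
    (rho : forall i, {rmorphism R -> Rs i})
    (Rs_local : forall i, local_ring (M i))
    (R_product : ring_product rho)
    (n : nat) (n_ge3 : (3 <= n)%N)
    (C : {set {set 'rV[R]_n}}) (C_cap : is_cap C) (C_neq2 : #|C| <> 2%N) :
  (forall i : 'I_l,
     is_kcap #|C| (image_points (rho i) C) /\
     is_kcap #|C| (image_points (residue_map (M i) \o rho i) C)) /\
  (complete_cap C <->
     exists i0 : 'I_l,
       complete_cap (image_points (residue_map (M i0) \o rho i0) C)).
Proof.
split=> [i|]; first split.
- exact: image_points_kcap.
- exact: (image_points_kcap (residue M rho i)).
split=> [complC | [i complCi]].
- exact: (residue_complete Rs_local R_product).
- exact: (@complete_cap_of_residue _ _ _ M rho _ _ i).
Qed.
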